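(* Let $G$ be a finite group acting on a sandpile graph $\Gamma=(V,E,\mathrm{wt},s)$. Then the collection of symmetric recurrent configurations on $\Gamma$ (recurrent configurations $c$ with $gc=c$ for all $g\in G$) forms a subgroup of the sandpile group $\mathcal{S}(\Gamma)$.
   Context: Sandpile graph: $\Gamma=(V,E,\mathrm{wt},s)$ is a finite directed graph with edge-weight function $\mathrm{wt}\colon V\times V\to\mathbb{N}=\{0,1,2,\dots\}$, $\mathrm{wt}(v,w)>0$ iff $(v,w)\in E$, and a vertex $s$ (the sink) such that every vertex has a directed path to $s$. Let $\widetilde V=V\setminus\{s\}$ and $\mathrm{outdeg}(v)=\sum_{w\in V}\mathrm{wt}(v,w)$. Configurations: a configuration is an element $c=\sum_{v\in\widetilde V}c_v v\in\mathbb{N}\widetilde V$. A vertex $v\in\widetilde V$ is unstable in $c$ if $c_v\ge\mathrm{outdeg}(v)$; firing it replaces $c$ by $c-\mathrm{outdeg}(v)v+\sum_{w\in\widetilde V}\mathrm{wt}(v,w)w$. Repeatedly firing unstable vertices leads in finitely many steps to a stable configuration (no unstable vertices) $c^\circ$, independent of the choices made. A configuration $c$ is recurrent if it is stable and for every configuration $a$ there is a configuration $b$ with $(a+b)^\circ=c$. The recurrent configurations form a group under $(a,b)\mapsto(a+b)^\circ$, the sandpile group $\mathcal{S}(\Gamma)$. Action: an action of $G$ on $\Gamma$ is an action of $G$ on the set $V$ with $gs=s$ for all $g\in G$ and such that $(v,w)\in E$ implies $(gv,gw)\in E$ with both edges having the same weight. It extends linearly to configurations. *)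

(* Defs.v *)
From HB Require Import structures.
From mathcomp Require Import all_boot all_order all_algebra all_fingroup.
From mathcomp Require Import boolp.

Set Implicit Arguments.
Unset Strict Implicit.
Unset Printing Implicit Defensive.

Import GRing.Theory.

Local Open Scope nat_scope.

Definition edge_of (V : finType) (wt : V -> V -> nat) : rel V :=
  fun v w => 0 < wt v w.

Record sandpile_graph := SandpileGraph {
  vertex :> finType;
  wt : vertex -> vertex -> nat;
  sink : vertex;
  sink_reachable : forall v : vertex, connect (edge_of wt) v sink
}.

Definition edge (Gr : sandpile_graph) : rel Gr := edge_of (@wt Gr).

Definition outdeg (Gr : sandpile_graph) (v : Gr) : nat := \sum_(w : Gr) wt v w.

Notation nonsink Gr := {v : vertex Gr | v != sink Gr}.

(* Addition of configurations is the library's pointwise addition of finite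
   functions, written (a + b)%R. *)
Notation config Gr := {ffun nonsink Gr -> nat}.

Definition unstable (Gr : sandpile_graph) (c : config Gr) (v : nonsink Gr) :
  bool := outdeg (val v) <= c v.

Definition stable (Gr : sandpile_graph) (c : config Gr) : bool :=
  [forall v, ~~ unstable c v].

(* Meaningful only when v is unstable in c; the subtraction is then exact. *)
Definition fire (Gr : sandpile_graph) (v : nonsink Gr) (c : config Gr) :
    config Gr :=
  [ffun w => c w - (if w == v then outdeg (val v) else 0)
             + wt (val v) (val w)].

Inductive firings (Gr : sandpile_graph) (c : config Gr) : config Gr -> Prop :=
| firings_nil : firings c c
| firings_cons (v : nonsink Gr) (d : config Gr) :
    unstable c v -> firings (fire v c) d -> firings c d.

Definition fire_some (Gr : sandpile_graph) (c : config Gr) : config Gr :=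
  if [pick v | unstable c v] is Some v then fire v c else c.

Lemma sink_distance (Gr : sandpile_graph) :
  exists d : Gr -> nat,
    forall v, v != sink Gr -> exists2 w, edge v w & d w < d v.
Proof.
pose P v n := [exists p : n.-tuple Gr,
  path (@edge Gr) v p && (last v p == sink Gr)].
have exP v : exists n, P v n.
  have /connectP[p ep ls] := sink_reachable v.
  by exists (size p); apply/existsP; exists (in_tuple p); rewrite /= ep -ls eqxx.
exists (fun v => ex_minn (exP v)) => v vs.
case: (ex_minnP (exP v)) => n /existsP[[p /= /eqP sp]] /andP[ep /eqP lp] _.
case: p sp ep lp => [|w p] /= sp; first by move=> _ vE; rewrite vE eqxx in vs.
move=> /andP[evw ep] lp; exists w => //.
case: ex_minnP => m _; rewrite -sp ltnS; apply.
by apply/existsP; exists (in_tuple p); rewrite /= ep lp eqxx.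
Qed.

Lemma sink_potential (Gr : sandpile_graph) :
  exists g : Gr -> nat,
    (forall v, g v <= g (sink Gr)) /\
    (forall v, v != sink Gr -> outdeg v * g v < \sum_w wt v w * g w).
Proof.
have [d0 d0P] := sink_distance Gr.
pose d v := if v == sink Gr then 0 else (d0 v).+1.
have dP v : v != sink Gr -> exists2 w, edge v w & d w < d v.
  move=> vs; have [w evw lt] := d0P v vs; exists w => //.
  by rewrite /d (negPf vs); case: ifP.
pose N := \max_v d v; pose M := (\max_(v : Gr) outdeg v).+1.
have dN v : d v <= N by apply: leq_bigmax.
exists (fun v => M ^ (N - d v)); split=> [v|v vs].
  by rewrite leq_pexp2l // /d eqxx subn0 leq_subr.
have [w evw lt] := dP v vs.
rewrite (bigD1 w) //=; apply: leq_trans (leq_addr _ _).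
apply: (@leq_trans (1 * M ^ (N - d w))); last by rewrite leq_mul2r; apply/orP; right; exact: evw.
rewrite mul1n; apply: (@leq_trans (M * M ^ (N - d v))).
  by rewrite ltn_mul2r expn_gt0 /= ltnS leq_bigmax.
rewrite -expnS leq_pexp2l //.
by rewrite ltn_sub2l // (leq_trans lt).
Qed.

Lemma fire_decreases (Gr : sandpile_graph) :
  exists pot : config Gr -> nat,
    forall c v, unstable c v -> pot (fire v c) < pot c.
Proof.
have [g [gs gP]] := sink_potential Gr.
pose f v := g (sink Gr) - g v.
exists (fun c => \sum_(u : nonsink Gr) c u * f (val u)) => c v cv.
have wtf : \sum_(w : nonsink Gr) wt (val v) (val w) * f (val w)
           < outdeg (val v) * f (val v).
  have -> : \sum_(w : nonsink Gr) wt (val v) (val w) * f (val w)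
            = \sum_w wt (val v) w * f w.
    rewrite [RHS](bigID (fun w => w != sink Gr)) /= [X in _ + X]big1 ?addn0.
      rewrite (reindex_omap (val : nonsink Gr -> Gr) insub) /=; last first.
        by move=> w ws; rewrite insubT.
      by apply: eq_bigl => w; rewrite valK eqxx (valP w).
    by move=> w; rewrite negbK => /eqP ->; rewrite /f subnn muln0.
  have -> : \sum_w wt (val v) w * f w
     = outdeg (val v) * g (sink Gr) - \sum_w wt (val v) w * g w.
    rewrite /outdeg big_distrl /= -sumnB => [|w _]; last by rewrite leq_mul.
    by apply: eq_bigr => w _; rewrite mulnBr.
  have lt := gP _ (valP v).
  rewrite mulnBr ltn_sub2l //; apply: leq_trans lt _.
  by rewrite /outdeg big_distrl leq_sum // => w _; rewrite leq_mul.
have -> : \sum_u c u * f (val u) = 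
   \sum_u (c u - (if u == v then outdeg (val v) else 0)) * f (val u)
   + outdeg (val v) * f (val v).
  rewrite (bigD1 v) //= [X in _ = X + _](bigD1 v) //= eqxx addnAC -mulnDl subnK //.
  by congr (_ + _); apply: eq_bigr => u /negPf ->; rewrite subn0.
rewrite (eq_bigr (fun u : nonsink Gr =>
   (c u - (if u == v then outdeg (val v) else 0)) * f (val u)
   + wt (val v) (val u) * f (val u))).
  by rewrite big_split /= ltn_add2l.
by move=> u _; rewrite ffunE mulnDl.
Qed.

Lemma stableN (Gr : sandpile_graph) (c : config Gr) (v : nonsink Gr) :
  stable c -> unstable c v = false.
Proof. by move=> /forallP/(_ v)/negPf. Qed.

Lemma fire_some_stable (Gr : sandpile_graph) (c : config Gr) n :
  (forall m, m < n -> ~~ stable (iter m (@fire_some Gr) c)) ->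
  firings c (iter n (@fire_some Gr) c).
Proof.
elim: n c => [|n IH] c ns; first exact: firings_nil.
rewrite iterSr; have := ns 0 isT; rewrite /= => /forallPn[v].
rewrite negbK => cv.
have IHc : firings (fire_some c) (iter n (@fire_some Gr) (fire_some c)).
  by apply: IH => m mn; rewrite -iterSr; apply: ns.
have [w cw fw] : exists2 w, unstable c w & fire_some c = fire w c.
  rewrite /fire_some; case: pickP => [w cw|/(_ v)]; last by rewrite cv.
  by exists w.
by apply: firings_cons cw _; rewrite -fw.
Qed.

Lemma stabilizes (Gr : sandpile_graph) (c : config Gr) :
  exists n, stable (iter n (@fire_some Gr) c).
Proof.
have [pot potP] := fire_decreases Gr.
have [k] := ubnP (pot c); elim: k c => // k IH c ck.
case: (boolP (stable c)) => [sc|/forallPn[v]]; first by exists 0.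
rewrite negbK => cv.
have [|n sn] := IH (fire_some c); last by exists n.+1; rewrite iterSr.
rewrite /fire_some; case: pickP => [w cw|/(_ v)]; last by rewrite cv.
exact: leq_trans (potP _ _ cw) ck.
Qed.

(* Fires some unstable vertex until none is left; [firings_stab] and
   [stab_unique] show that the choices made are irrelevant. *)
Definition stab (Gr : sandpile_graph) (c : config Gr) : config Gr :=
  iter (ex_minn (stabilizes c)) (@fire_some Gr) c.

Lemma stab_stable (Gr : sandpile_graph) (c : config Gr) : stable (stab c).
Proof. by rewrite /stab; case: ex_minnP. Qed.

Lemma firings_stab (Gr : sandpile_graph) (c : config Gr) : firings c (stab c).
Proof.
rewrite /stab; case: ex_minnP => n _ min_n; apply: fire_some_stable => m mn.
by apply: contraL mn => /min_n; rewrite -leqNgt.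
Qed.

Lemma fireC (Gr : sandpile_graph) (c : config Gr) (u v : nonsink Gr) :
  u != v -> unstable c u -> unstable c v ->
  fire u (fire v c) = fire v (fire u c).
Proof.
rewrite /unstable => uv cu cv; apply/ffunP => w; rewrite !ffunE.
case: (eqVneq w u) => [->|wu].
  by rewrite (negPf uv) !subn0 -addnBAC // addnAC.
rewrite !subn0; case: eqP => [->|_]; last by rewrite !subn0 addnAC.
by rewrite -addnBAC // addnAC.
Qed.

Lemma unstable_fire (Gr : sandpile_graph) (c : config Gr) (u v : nonsink Gr) :
  u != v -> unstable c u -> unstable (fire v c) u.
Proof.
move=> uv; rewrite /unstable ffunE (negPf uv) subn0 => h.
exact: leq_trans h (leq_addr _ _).
Qed.

Lemma stab_unique (Gr : sandpile_graph) (c d : config Gr) :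
  firings c d -> stable d -> d = stab c.
Proof.
have [pot potP] := fire_decreases Gr.
suff H k c1 d1 d2 : pot c1 < k -> firings c1 d1 -> stable d1 ->
    firings c1 d2 -> stable d2 -> d1 = d2.
  by move=> cd sd; apply: (H (pot c).+1 c) => //;
    [exact: firings_stab | exact: stab_stable].
elim: k c1 d1 d2 => // k IH c1 d1 d2 ck.
case=> [|u e1 cu r1] s1; case=> [|v e2 cv r2] s2 //.
- by rewrite (stableN v s1) in cv.
- by rewrite (stableN u s2) in cu.
have pu := leq_trans (potP _ _ cu) ck; have pv := leq_trans (potP _ _ cv) ck.
case: (eqVneq u v) => [uv|uv]; first by subst v; exact: IH pu r1 s1 r2 s2.
pose e := stab (fire u (fire v c1)).
have se : stable e by exact: stab_stable.
have re : firings (fire u (fire v c1)) e by exact: firings_stab.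
transitivity e.
  apply: (IH _ _ _ pu r1 s1 _ se); apply: (@firings_cons _ _ v).
    by apply: unstable_fire; rewrite // eq_sym.
  by rewrite -fireC.
apply/esym; apply: (IH _ _ _ pv r2 s2 _ se); apply: (@firings_cons _ _ u) => //.
exact: unstable_fire.
Qed.

Lemma firings_trans (Gr : sandpile_graph) (a b c : config Gr) :
  firings a b -> firings b c -> firings a c.
Proof. by elim=> // {}a v {}b av _ IH /IH; apply: firings_cons. Qed.

Lemma firingsD (Gr : sandpile_graph) (a a' b : config Gr) :
  firings a a' -> firings (a + b)%R (a' + b)%R.
Proof.
elim=> [{}a|{}a v {}a' av _ IH]; first exact: firings_nil.
apply: (@firings_cons _ _ v).
  by rewrite /unstable !ffunE (leq_trans av) // leq_addr.
suff <- : (fire v a + b)%R = fire v (a + b)%R by [].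
have subDD m n k p : n <= m -> (m - n + k) + p = (m + p) - n + k.
  by move=> nm; rewrite -addnBAC // addnAC.
by apply/ffunP => w; rewrite !ffunE; apply: subDD; case: eqP => [->|].
Qed.

Lemma stabDl (Gr : sandpile_graph) (a b : config Gr) :
  stab (stab a + b)%R = stab (a + b)%R.
Proof.
apply: stab_unique (stab_stable _); apply: firings_trans (firings_stab _).
exact: firingsD (firings_stab _).
Qed.

Lemma stabDr (Gr : sandpile_graph) (a b : config Gr) :
  stab (a + stab b)%R = stab (a + b)%R.
Proof. by rewrite addrC stabDl addrC. Qed.

Lemma stab_id (Gr : sandpile_graph) (c : config Gr) : stable c -> stab c = c.
Proof. by move=> sc; apply/esym/stab_unique => //; exact: firings_nil. Qed.

Definition recurrent (Gr : sandpile_graph) (c : config Gr) : Prop :=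
  stable c /\ forall a : config Gr, exists b : config Gr, stab (a + b)%R = c.

Record sandpile_group (Gr : sandpile_graph) := SandpileGroup {
  rec_config :> config Gr;
  rec_configP : `[< recurrent rec_config >]
}.

HB.instance Definition _ (Gr : sandpile_graph) :=
  [isSub for @rec_config Gr].
HB.instance Definition _ (Gr : sandpile_graph) :=
  [Choice of sandpile_group Gr by <:].

Lemma outdeg_gt0 (Gr : sandpile_graph) (v : Gr) :
  v != sink Gr -> 0 < outdeg v.
Proof.
have [d dP] := sink_distance Gr => /dP[w evw _].
by rewrite /outdeg (bigD1 w) //= (leq_trans evw) ?leq_addr.
Qed.

Definition max_stable (Gr : sandpile_graph) : config Gr :=
  [ffun v => (outdeg (val v)).-1].

Lemma max_stable_recurrent (Gr : sandpile_graph) : recurrent (max_stable Gr).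
Proof.
have sm : stable (max_stable Gr).
  apply/forallP => v; rewrite /unstable ffunE -ltnNge prednK //.
  exact: outdeg_gt0 (valP v).
split=> // a; exists [ffun v => max_stable Gr v - stab a v].
rewrite -stabDl -[RHS]stab_id //; congr stab; apply/ffunP => v; rewrite !ffunE.
have /forallP/(_ v) := stab_stable a.
rewrite /unstable -ltnNge => lt; apply: subnKC.
by rewrite -ltnS prednK // (leq_ltn_trans _ lt).
Qed.

Lemma recurrent_stabD (Gr : sandpile_graph) (c d : config Gr) :
  recurrent c -> recurrent (stab (c + d)%R).
Proof.
move=> [_ cP]; split=> [|a]; first exact: stab_stable.
have [b bc] := cP a; exists (b + d)%R.
by rewrite -bc stabDl addrA.
Qed.

Definition sadd (Gr : sandpile_graph) (x y : sandpile_group Gr) :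
    sandpile_group Gr :=
  SandpileGroup
    (asboolT (recurrent_stabD (rec_config y) (asboolW (rec_configP x)))).

Lemma saddA (Gr : sandpile_graph) : associative (@sadd Gr).
Proof. by move=> x y z; apply/val_inj; rewrite /= stabDl stabDr addrA. Qed.

Lemma saddC (Gr : sandpile_graph) : commutative (@sadd Gr).
Proof. by move=> x y; apply/val_inj; rewrite /= addrC. Qed.

Lemma sdiv_ex (Gr : sandpile_graph) (x y : sandpile_group Gr) :
  exists z, sadd x z == y.
Proof.
have [sy yP] := asboolW (rec_configP y).
have [b xby] := yP (rec_config x + max_stable Gr)%R.
pose z := recurrent_stabD b (max_stable_recurrent Gr).
by exists (SandpileGroup (asboolT z)); apply/eqP/val_inj; rewrite /= stabDr addrA.
Qed.

Definition smax (Gr : sandpile_graph) : sandpile_group Gr :=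
  SandpileGroup (asboolT (max_stable_recurrent Gr)).

(* The neutral element is in general not the zero configuration, which need not
   be recurrent. *)
Definition szero (Gr : sandpile_graph) : sandpile_group Gr :=
  xchoose (sdiv_ex (smax Gr) (smax Gr)).

Lemma sadd0 (Gr : sandpile_graph) : left_id (szero Gr) (@sadd Gr).
Proof.
move=> x; have [z /eqP <-] := sdiv_ex (smax Gr) x.
rewrite saddA [sadd (szero Gr) _]saddC; congr (sadd _ z).
exact/eqP/(xchooseP (sdiv_ex (smax Gr) (smax Gr))).
Qed.

Definition sopp (Gr : sandpile_graph) (x : sandpile_group Gr) :
  sandpile_group Gr := xchoose (sdiv_ex x (szero Gr)).

Lemma saddN (Gr : sandpile_graph) :
  left_inverse (szero Gr) (@sopp Gr) (@sadd Gr).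
Proof. by move=> x; rewrite saddC (eqP (xchooseP (sdiv_ex x _))). Qed.

HB.instance Definition _ (Gr : sandpile_graph) :=
  GRing.isZmodule.Build (sandpile_group Gr)
    (@saddA Gr) (@saddC Gr) (@sadd0 Gr) (@saddN Gr).

Lemma rec_configD (Gr : sandpile_graph) (x y : sandpile_group Gr) :
  rec_config (x + y)%R = stab (rec_config x + rec_config y)%R.
Proof. by []. Qed.

(* MathComp actions are right actions; a left action v |-> g v is represented
   by to v g = g^-1 v, which changes neither the conditions below, stated for
   all g in G, nor the set of symmetric configurations. *)
Definition sandpile_action (Gr : sandpile_graph) (gT : finGroupType)
    (G : {group gT}) (to : action G Gr) : Prop :=
  (forall g, g \in G -> to (sink Gr) g = sink Gr) /\
  (forall g, g \in G -> forall v w : Gr, edge v w ->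
     edge (to v g) (to w g) /\ wt (to v g) (to w g) = wt v w).

(* The linear extension: \sum_v c_v v is mapped to \sum_v c_v (to v g), whose
   coefficient at w collects the c_v with to v g = w. *)
Definition config_act (Gr : sandpile_graph) (gT : finGroupType)
    (G : {group gT}) (to : action G Gr) (c : config Gr) (g : gT) : config Gr :=
  [ffun w : nonsink Gr =>
    \sum_(v : nonsink Gr | to (val v) g == val w) c v].

Definition symmetric_config (Gr : sandpile_graph) (gT : finGroupType)
    (G : {group gT}) (to : action G Gr) (c : config Gr) : bool :=
  [forall g in G, config_act to c g == c].

Definition symmetric_recurrent (Gr : sandpile_graph) (gT : finGroupType)
    (G : {group gT}) (to : action G Gr) : {pred sandpile_group Gr} :=
  [pred c : sandpile_group Gr | symmetric_config to c].

(* Main.v *)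
(** A graph automorphism fixing the sink commutes with firing, hence with
    stabilization, so it acts on recurrent configurations by automorphisms of
    the sandpile group. The symmetric recurrent configurations are the fixed
    points of this action by automorphisms. *)

Require Import Defs.
From mathcomp Require Import all_boot all_order all_algebra all_fingroup.
From mathcomp Require Import boolp.

Set Implicit Arguments.
Unset Strict Implicit.
Unset Printing Implicit Defensive.

Import GRing.Theory.

Section SandpileAction.

Variables (Gr : sandpile_graph) (gT : finGroupType) (G : {group gT}).
Variable to : action G Gr.
Hypothesis hto : sandpile_action to.

(** The action hypothesis speaks only of edges. A non-edge has weight 0, and so does its image: if
    the image were an edge, acting by [g^-1] would bring the weight back to the original pair. *)
Lemma wt_act g v w : g \in G -> wt (to v g) (to w g) = wt v w.
Proof.
move=> Gg; have [_ wtE] := hto.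
have [evw|] := boolP (edge v w); first by have [] := wtE g Gg v w evw.
rewrite /edge /edge_of -eqn0Ngt => /eqP nvw.
have [egvw|] := boolP (edge (to v g) (to w g)); last first.
  by rewrite /edge /edge_of -eqn0Ngt nvw => /eqP.
have [_] := wtE g^-1%g (groupVr Gg) _ _ egvw.
by rewrite !(actKin to Gg).
Qed.

Lemma outdeg_act g v : g \in G -> outdeg (to v g) = outdeg v.
Proof.
move=> Gg; rewrite /outdeg (reindex_inj (@act_inj _ _ _ to g)).
by apply: eq_bigr => w _; rewrite wt_act.
Qed.

Lemma act_neq_sink g v : g \in G -> v != sink Gr -> to v g != sink Gr.
Proof.
move=> Gg; have [sinkE _] := hto.
by rewrite -{2}(sinkE g Gg) (inj_eq (@act_inj _ _ _ to g)).
Qed.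

Lemma nonsink_act g (v : nonsink Gr) :
  g \in G -> exists w : nonsink Gr, to (val v) g = val w.
Proof. by move=> Gg; exists (exist (fun u : Gr => u != sink Gr) _ (act_neq_sink Gg (valP v))). Qed.

Lemma nonsink_actV g (w : nonsink Gr) :
  g \in G -> exists v : nonsink Gr, to (val v) g = val w.
Proof.
move=> Gg; have [v vE] := nonsink_act w (groupVr Gg); exists v.
by rewrite -vE (actKVin to Gg).
Qed.

(** Since [to _ g] is injective, only the term at [v] survives in the sum defining [config_act]. *)
Lemma config_actE g (c : config Gr) (v w : nonsink Gr) :
  to (val v) g = val w -> config_act to c g w = c v.
Proof.
move=> vw; rewrite ffunE -vw; apply: big_pred1 => u.
by rewrite /= (inj_eq (@act_inj _ _ _ to g)).
Qed.

Lemma config_actD g (c d : config Gr) :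
  config_act to (c + d)%R g = (config_act to c g + config_act to d g)%R.
Proof.
apply/ffunP => w; rewrite !ffunE -big_split.
by apply: eq_bigr => v _; rewrite !ffunE.
Qed.

Lemma config_actKV g (c : config Gr) :
  g \in G -> config_act to (config_act to c g^-1%g) g = c.
Proof.
move=> Gg; apply/ffunP => w; have [v vw] := nonsink_actV w Gg.
by rewrite (config_actE _ vw) (@config_actE _ _ w) // -vw (actKin to Gg).
Qed.

Lemma unstable_act g (c : config Gr) (v w : nonsink Gr) :
  g \in G -> to (val v) g = val w ->
  unstable (config_act to c g) w = unstable c v.
Proof.
by move=> Gg vw; rewrite /unstable (config_actE _ vw) -vw outdeg_act.
Qed.

Lemma stable_act g (c : config Gr) :
  g \in G -> stable c -> stable (config_act to c g).
Proof.
move=> Gg /forallP sc; apply/forallP => w; have [v vw] := nonsink_actV w Gg.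
by rewrite (unstable_act _ Gg vw).
Qed.

Lemma fire_act g (c : config Gr) (v w : nonsink Gr) :
  g \in G -> to (val v) g = val w ->
  config_act to (fire v c) g = fire w (config_act to c g).
Proof.
move=> Gg vw; apply/ffunP => w'; have [v' vw'] := nonsink_actV w' Gg.
rewrite (config_actE _ vw') [in RHS]ffunE (config_actE _ vw') ffunE.
(* By injectivity, [w'] is the fired vertex [w] exactly when its preimage [v'] is [v]. *)
rewrite -[w' == w]val_eqE /= -vw -vw' (inj_eq (@act_inj _ _ _ to g)) val_eqE.
by rewrite wt_act // outdeg_act.
Qed.

Lemma firings_act g (c d : config Gr) :
  g \in G -> firings c d -> firings (config_act to c g) (config_act to d g).
Proof.
move=> Gg; elim=> [{}c|{}c v {}d cv _ IH]; first exact: firings_nil.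
have [w vw] := nonsink_act v Gg; apply: (@firings_cons _ _ w).
  by rewrite (unstable_act _ Gg vw).
by rewrite -(fire_act _ Gg vw).
Qed.

(** The image of a legal firing sequence is legal and ends in a stable configuration, so uniqueness
    of stabilization applies. *)
Lemma stab_act g (c : config Gr) :
  g \in G -> config_act to (stab c) g = stab (config_act to c g).
Proof.
move=> Gg; apply: stab_unique; last exact: stable_act (stab_stable c).
exact: firings_act (firings_stab c).
Qed.

Lemma recurrent_act g (c : config Gr) :
  g \in G -> recurrent c -> recurrent (config_act to c g).
Proof.
move=> Gg [sc cP]; split=> [|a]; first exact: stable_act.
(* Pull [a] back by [g^-1], complete it to [c] by recurrence, and push the completing [b] forward by
   [g]. *)
have [b <-] := cP (config_act to a g^-1%g); exists (config_act to b g).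
by rewrite stab_act // config_actD config_actKV.
Qed.

Definition sandpile_group_act g (Gg : g \in G) (x : sandpile_group Gr) :
    sandpile_group Gr :=
  SandpileGroup (asboolT (recurrent_act Gg (asboolW (rec_configP x)))).

Lemma sandpile_group_actD g (Gg : g \in G) :
  {morph sandpile_group_act Gg : x y / (x + y)%R}.
Proof. by move=> x y; apply/val_inj; rewrite /= stab_act // config_actD. Qed.

(** The neutral element has no explicit formula as a configuration, so its invariance comes from
    additivity and cancellation. *)
Lemma sandpile_group_act0 g (Gg : g \in G) :
  sandpile_group_act Gg 0%R = 0%R.
Proof.
by apply: (addrI (sandpile_group_act Gg 0%R)); rewrite -sandpile_group_actD !addr0.
Qed.

Lemma symmetric_recurrentP (x : sandpile_group Gr) :
  x \in symmetric_recurrent to <->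
  forall g (Gg : g \in G), sandpile_group_act Gg x = x.
Proof.
split=> [/forall_inP sym_x g Gg|fix_x].
  by apply/val_inj/eqP/sym_x.
by apply/forall_inP => g Gg; rewrite -[X in _ == rec_config X](fix_x g Gg).
Qed.

End SandpileAction.

Theorem proposition2p6 (Gr : sandpile_graph) (gT : finGroupType)
    (G : {group gT}) (to : action G Gr) (hto : sandpile_action to) :
  GRing.zmod_closed (symmetric_recurrent to).
Proof.
have symP := symmetric_recurrentP hto.
split=> [|x y /symP fix_x /symP fix_y]; apply/symP => g Gg.
  exact: sandpile_group_act0.
(* Adding [y], which [g] fixes, turns the invariance of [x - y] into that of [x]. *)
apply: (addIr y); rewrite -{2}(fix_y g Gg) -sandpile_group_actD !subrK.
exact: fix_x.
Qed.
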